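(* For every integer $n\ge0$, $$\sum_{m\ge0}\frac{m^n}{n+1}\binom{m+n}{m}t^m=\frac{\overline{Q}_n(t)}{(1-t)^{2n+1}},$$ where $\overline{Q}_n(t)=\sum_{\pi}t^{\operatorname{des}(\pi)}$, the sum ranging over all quasi-Stirling permutations $\pi$ of size $n$.
   Context: A quasi-Stirling permutation of size $n$ is a permutation $\pi_1\cdots\pi_{2n}$ of the multiset $\{1,1,2,2,\dots,n,n\}$ with no indices $i<j<k<\ell$ such that $\pi_i=\pi_k$ and $\pi_j=\pi_\ell$ (for $n=0$ only the empty permutation). For a sequence $\pi_1\cdots\pi_r$, an index $i\in\{1,\dots,r\}$ is a descent if $\pi_i>\pi_{i+1}$ or $i=r$, and $\operatorname{des}$ counts descents. The identity is one of formal power series in $t$, with the convention $0^0=1$. *)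

(* Defs.v *)
From HB Require Import structures.
From mathcomp Require Import all_boot all_order all_algebra.
Set Implicit Arguments. Unset Strict Implicit. Unset Printing Implicit Defensive.
Import Order.TTheory GRing.Theory Num.Theory.
Local Open Scope ring_scope.

(* Formal power series over rat, represented by their coefficient sequences. *)
Definition fps := nat -> rat.

Definition fps_mul (f g : fps) : fps :=
  fun m => \sum_(i < m.+1) f i * g (m - i)%N.

Definition fps_of_poly (p : {poly rat}) : fps := fun m => p`_m.

Definition des (s : seq nat) : nat :=
  \sum_(i < size s) ((i.+1 == size s) || (nth 0%N s i.+1 < nth 0%N s i)%N).

Definition word_seq (n : nat) (w : (2 * n).-tuple 'I_n.+1) : seq nat :=
  map (fun x : 'I_n.+1 => nat_of_ord x) w.

(* w is a permutation of the multiset {1,1,2,2,...,n,n}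
   (each k in 1..n occurs exactly twice; since the length is 2n, 0 does not occur). *)
Definition is_multiset_perm (n : nat) (w : (2 * n).-tuple 'I_n.+1) : bool :=
  [forall k : 'I_n.+1, (0 < k)%N ==> (count_mem (nat_of_ord k) (word_seq w) == 2%N)].

Definition avoids_1212 (n : nat) (w : (2 * n).-tuple 'I_n.+1) : bool :=
  ~~ [exists i : 'I_(2 * n), exists j : 'I_(2 * n), exists k : 'I_(2 * n),
        exists l : 'I_(2 * n),
        [&& (i < j)%N, (j < k)%N, (k < l)%N,
            tnth w i == tnth w k & tnth w j == tnth w l]].

Definition quasi_stirling (n : nat) (w : (2 * n).-tuple 'I_n.+1) : bool :=
  is_multiset_perm w && avoids_1212 w.

Definition Qbar (n : nat) : {poly rat} :=
  \sum_(w : (2 * n).-tuple 'I_n.+1 | quasi_stirling w) 'X^(des (word_seq w)).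

(* Coefficient sequence of the left-hand side: m^n/(n+1) * binom(m+n, m), with 0^0 = 1. *)
Definition lhs_series (n : nat) : fps :=
  fun m => (m%:R ^+ n) / (n.+1)%:R * ('C(m + n, m))%:R.

(* Main.v *)
From HB Require Import structures.
Require Import Defs.
From mathcomp Require Import all_boot all_order all_algebra.
From mathcomp Require Import ring zify.
From Stdlib Require Import FunctionalExtensionality.
Set Implicit Arguments. Unset Strict Implicit. Unset Printing Implicit Defensive.
Import GRing.Theory.

(** A quasi-Stirling word with least letter [a] is uniquely [u a v a z], where [v]
    and [u z] are quasi-Stirling words on complementary sets of the other letters.
    Of the [2k + 1] cuts of a word [u z] of size [k], exactly [des (u z)] give
    [des (u a v a z) = des v + des (u z)]; the others give one descent more.
    Hence [h_n := Qbar_n(t) / (1 - t)^(2n+1)] satisfies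
    [h_(n+1) = \sum_k 'C(n, k) h_(n-k) theta(h_k)] with [theta = t d/dt], i.e.
    [H = \sum_n h_n z^n / n!] solves the Burgers equation [dH/dz = H theta(H)].
    It follows that [(n + 1) h_n = theta^n (h_0^(n+1)) = theta^n ((1 - t)^-(n+1))],
    whose coefficients are read off directly.  All [h_n] are polynomials in
    [x = 1 / (1 - t)], on which [theta] acts as [(x^2 - x) d/dx]; the computation
    takes place in [rat[x]]. *)

(** * Descents *)

Lemma des_nil : des [::] = 0.
Proof. by rewrite /des big_ord0. Qed.

Lemma des_seq1 x : des [:: x] = 1.
Proof. by rewrite /des big_ord_recl big_ord0. Qed.

Lemma des_cons2 x y s : des [:: x, y & s] = (y < x) + des (y :: s).
Proof. by rewrite /des big_ord_recl. Qed.

Lemma des_size s : des s <= size s.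
Proof.
rewrite /des -[leqRHS]card_ord -sum1_card.
by apply: leq_sum => i _; rewrite leq_b1.
Qed.

(** The last letter of a nonempty [u] is a descent on both sides: as the final index of [u], and as
    a letter followed by the smaller [a]. *)
Lemma des_cat_min a u s : all (fun y => a < y) u ->
  des (u ++ a :: s) = des u + des (a :: s).
Proof.
elim: u => [|x [|y u] IH] //=; first by rewrite des_nil.
  by rewrite andbT => ax; rewrite des_cons2 des_seq1 ax.
by case/andP=> ax yu; rewrite !des_cons2 IH // addnA.
Qed.

Lemma des_cons_min a s : all (fun y => a < y) s ->
  des (a :: s) = nilp s + des s.
Proof.
case: s => [|y s] /=; first by rewrite des_seq1 des_nil.
by case/andP=> ay _; rewrite des_cons2 ltnNge (ltnW ay).
Qed.

Definition surround (a : nat) (v : seq nat) (uw : seq nat * seq nat) :=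
  uw.1 ++ a :: v ++ a :: uw.2.

(** The last letters of [v] and of [uw.1] remain descents, being followed by [a]. The first [a] is
    never a descent; the second is one only at the end of the whole word, hence the term
    [nilp uw.2]. *)
Lemma des_surround a v uw :
  all (fun y => a < y) v -> all (fun y => a < y) uw.1 ->
  all (fun y => a < y) uw.2 ->
  des (surround a v uw) = des v + (des uw.1 + des uw.2 + nilp uw.2).
Proof.
case: uw => u w /= av au aw; rewrite /surround des_cat_min //=.
suff -> : des (a :: v ++ a :: w) = des v + (nilp w + des w) by lia.
rewrite -(des_cons_min aw); case: v av => [|y v] /=.
  by rewrite des_nil des_cons2 ltnn.
by case/andP=> ay av; rewrite des_cons2 -cat_cons des_cat_min /= ?ay // ltnNge (ltnW ay).
Qed.

Definition cuts (r : seq nat) :=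
  [seq (take i r, drop i r) | i <- iota 0 (size r).+1].

Definition gap_des (uw : seq nat * seq nat) := des uw.1 + des uw.2 + nilp uw.2.

Lemma cuts_cons x r :
  cuts (x :: r) = ([::], x :: r) :: [seq (x :: uw.1, uw.2) | uw <- cuts r].
Proof.
have iotaE k : iota 0 k.+2 = 0 :: map S (iota 0 k.+1) by rewrite -(iotaDl 1).
by rewrite /cuts [size _]/= iotaE /= -!map_comp.
Qed.

(* Inserting a least letter into a nonempty word adds no descent at the front and
   at the interior descents, and one descent in every other gap. *)
Lemma sum_cuts (R : zmodType) (f : nat -> R) (r : seq nat) :
  (\sum_(uw <- cuts r) f (gap_des uw) =
   f (des r) *+ des r + f (des r).+1 *+ ((size r).+1 - des r))%R.
Proof.
elim: r f => [|x [|y r] IH] f.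
- by rewrite /cuts /= big_seq1 /gap_des /= des_nil mulr0n add0r.
- rewrite cuts_cons big_cons big_map /cuts /= big_seq1 /gap_des /=.
  by rewrite des_seq1 des_nil.
have gap0 s : gap_des ([::], s) = des s + nilp s by rewrite /gap_des des_nil.
have gap1 s : gap_des ([:: x], s) = (des s + nilp s).+1.
  by rewrite /gap_des des_seq1 add1n addSn.
(* Prefixing [x] to a cut whose left part starts with [y] adds [(y < x)] to its [gap_des]. The two
   cuts with at most [x] on the left are treated apart, by [gap0] and [gap1]. *)
have {IH} := IH (fun d => f ((y < x) + d))%N.
rewrite !cuts_cons; move: (cuts r) => c; rewrite big_cons map_cons !big_cons !big_map.
rewrite !gap0 gap1 des_cons2 /= !addn0.
rewrite [X in _ -> (_ + (_ + X))%R = _](eq_bigr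
  (fun uw => f ((y < x) + gap_des (y :: uw.1, uw.2)))); last first.
  by move=> uw _; rewrite /gap_des /= des_cons2 !addnA.
set d := des (y :: r); set S := (\sum_(_ <- _) _)%R.
have : (d <= (size r).+1)%N by exact: des_size (y :: r).
case: (y < x) => /= led.
  rewrite !add1n => E; rewrite [(f _ + S)%R]E.
  have -> : ((size r).+3 - d.+1 = (size r).+2 - d)%N by lia.
  by rewrite mulrS addrA.
rewrite !add0n => E; rewrite addrCA [(f _ + S)%R]E.
have -> : ((size r).+3 - d = ((size r).+2 - d).+1)%N by lia.
by rewrite [in RHS]mulrS addrCA.
Qed.

(** * Enumeration of quasi-Stirling words *)

Fixpoint splits (T : Type) (s : seq T) : seq (seq T * seq T) :=
  if s is x :: s' then
    [seq (x :: ab.1, ab.2) | ab <- splits s'] ++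
    [seq (ab.1, x :: ab.2) | ab <- splits s']
  else [:: ([::], [::])].

(* [n] is a recursion bound, to be taken at least [size s]. *)
Fixpoint qs_words (n : nat) (s : seq nat) : seq (seq nat) :=
  match n, s with
  | _, [::] => [:: [::]]
  | n'.+1, a :: s' =>
      [seq surround a x.1 x.2
        | x <- [seq x | ab <- splits s',
             x <- [seq (v, uw) | v <- qs_words n' ab.1,
                                 uw <- [seq uw | r <- qs_words n' ab.2, uw <- cuts r]]]]
  | _, _ => [::]
  end.

(** The 1212 condition in terms of letters instead of positions, so that subwords inherit it at
    once. *)
Definition noncrossing (w : seq nat) :=
  forall x y, ~~ subseq [:: x; y; x; y] w.

(** A split is encoded by the predicate selecting its first component. As [a] is not in [s], the
    predicate can be given either value at [a] without changing the filters of [s]. *)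
Lemma splitsP (s : seq nat) ab : uniq s ->
  reflect (exists p, ab = ([seq x <- s | p x], [seq x <- s | ~~ p x]))
          (ab \in splits s).
Proof.
elim: s ab => [|a s IH] ab.
  move=> _; rewrite inE; apply: (iffP eqP) => [->|[p ->]] //.
  by exists xpredT.
case/andP=> nas us; rewrite mem_cat; apply: (iffP orP).
  case=> /mapP[[b c] /(IH _ us)[p [-> ->]] ->].
    exists (fun x => (x == a) || p x); rewrite /= eqxx /=.
    by congr (_ :: _, _); apply: eq_in_filter => x xs;
       case: eqP => // xa; rewrite -xa xs in nas.
  exists (fun x => (x != a) && p x); rewrite /= eqxx /=.
  by congr (_, _ :: _); apply: eq_in_filter => x xs;
       case: eqP => // xa; rewrite -xa xs in nas.
move=> [p ->] /=; case: ifP => pa; [left|right]; apply/mapP;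
  exists ([seq x <- s | p x], [seq x <- s | ~~ p x]) => //; apply/IH => //;
  by exists p.
Qed.

Lemma cutsP r uw : reflect (r = uw.1 ++ uw.2) (uw \in cuts r).
Proof.
apply: (iffP mapP) => [[i _ ->]|->]; first by rewrite cat_take_drop.
exists (size uw.1); first by rewrite mem_iota /= add0n ltnS size_cat leq_addr.
by rewrite take_size_cat // drop_size_cat //; case: uw.
Qed.

Lemma mem_qs_words_cons n a s w :
  reflect (exists ab v u z, [/\ ab \in splits s, v \in qs_words n ab.1,
     u ++ z \in qs_words n ab.2 & w = surround a v (u, z)])
    (w \in qs_words n.+1 (a :: s)).
Proof.
apply: (iffP mapP) => [[x]|[ab [v [u [z [abs vs us ->]]]]]].
  case/allpairsPdep=> ab [_ [abs /allpairsP[[v uw] [vs uws ->]] ->]] ->.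
  case/allpairsPdep: uws => r [[u z] [rs /cutsP rE uwE]].
  by exists ab, v, u, z; split; rewrite // -?rE //; congr (surround a v _).
exists (v, (u, z)) => //; apply/allpairsPdep; exists ab, (v, (u, z)); split=> //.
apply/allpairsP; exists (v, (u, z)); split=> //.
by apply/allpairsPdep; exists (u ++ z), (u, z); split=> //; apply/cutsP.
Qed.

Lemma subseq_catP (T : eqType) (t s1 s2 : seq T) :
  subseq t (s1 ++ s2) ->
  exists t1 t2, [/\ t = t1 ++ t2, subseq t1 s1 & subseq t2 s2].
Proof.
case/subseqP=> m; rewrite size_cat => sm ->.
rewrite -[m](cat_take_drop (size s1)) mask_cat; last by rewrite size_takel // sm leq_addr.
by do 2!eexists; split; [reflexivity|exact: mask_subseq..].
Qed.

Lemma noncrossing_subseq s w : subseq s w -> noncrossing w -> noncrossing s.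
Proof. by move=> sw ncw x y; apply: contra (ncw x y) => /subseq_trans; exact. Qed.

(** A pattern [x y x y] with both letters in [v] lies in [v], and with none in [v] it lies in
    [u ++ w]. With exactly one in [v], its two copies lie in a contiguous block, which would have to
    contain the foreign letter between them. *)
Lemma noncrossing_insert u v w :
  {in v, forall x, x \notin u ++ w} -> noncrossing v -> noncrossing (u ++ w) ->
  noncrossing (u ++ v ++ w).
Proof.
move=> dis ncv ncuw x y; apply/negP => sub.
have filt (p : pred nat) s : all p s -> subseq s (u ++ v ++ w) ->
    subseq s ([seq z <- u | p z] ++ [seq z <- v | p z] ++ [seq z <- w | p z]).
  by move=> ps ss; rewrite -!filter_cat subseq_filter ps.
have inv z : z \in v -> (z \in u = false) * (z \in w = false).
  by move=> /dis; rewrite mem_cat => /norP[/negPf-> /negPf->].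
have filt0 s : {in v, forall z, z \notin s} -> [seq z <- s | z \in v] = [::].
  move=> dsv; apply/eqP; rewrite -size_eq0 size_filter -leqn0 leqNgt -has_count.
  by apply/hasPn=> z zs; apply: contraL zs => /dsv.
have filt1 s : {in v, forall z, z \notin s} -> [seq z <- s | z \notin v] = s.
  move=> dsv; apply/all_filterP/allP => z zs.
  by apply: contraL zs => /dsv.
have du : {in v, forall z, z \notin u} by move=> z /inv[->].
have dw : {in v, forall z, z \notin w} by move=> z /inv[_ ->].
have subv s : all (mem v) s -> subseq s (u ++ v ++ w) -> subseq s v.
  move=> /filt f /f; rewrite (filt0 u) // (filt0 w) // cats0 /=.
  by move/subseq_trans; apply; exact: filter_subseq.
have subuw s : all (fun z => z \notin v) s -> subseq s (u ++ v ++ w) -> subseq s (u ++ w).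
  move=> /filt f /f; rewrite (filt1 u) // (filt1 w) //.
  rewrite (_ : [seq z <- v | z \notin v] = [::]) //.
  by apply/eqP; rewrite -size_eq0 size_filter -leqn0 leqNgt -has_count; apply/hasPn=> z /= ->.
have [t1 [t23 [E s1 /subseq_catP[t2 [t3 [E23 s2 s3]]]]]] := subseq_catP sub.
move: (mem_subseq s1) (mem_subseq s2) (mem_subseq s3) => m1 m2 m3.
case xv: (x \in v); case yv: (y \in v).
- by move: (ncv x y); rewrite subv //= xv yv.
(* A nonempty [t1] would start with [x], so [t1] is empty. Lacking [y], [t2] has at most one letter,
   which leaves an [x] for [t3]. *)
- case: t1 E m1 {s1} => [|z t1] /= E m1; last first.
    by case: E m1 => <- _ /(_ x (mem_head _ _)); rewrite (inv x xv).
  have x3 : x \notin t3 by apply/negP => /m3; rewrite (inv x xv).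
  have y2 : y \notin t2 by apply/negP => /m2; rewrite yv.
  move: E23 x3 y2; rewrite -E; case: t2 {s2 m2} => [|z1 [|z2 t2]] /=.
  + by move=> <-; rewrite mem_head.
  + by move=> [_ <-]; rewrite !inE eqxx !orbT.
  + by move=> [_ <- _]; rewrite !inE eqxx !orbT.
- have y1 : y \notin t1 by apply/negP => /m1; rewrite (inv y yv).
  have x2 : x \notin t2 by apply/negP => /m2; rewrite xv.
  have y3 : y \notin t3 by apply/negP => /m3; rewrite (inv y yv).
  case/lastP: t3 E23 y3 {s3 m3} => [|t3 z] E23.
    rewrite E23 cats0 in E => _; case: t1 E y1 {s1 m1} => [|z1 [|z2 t1]] /=.
    + by move=> Et; rewrite -Et mem_head in x2.
    + by move=> [_ Et]; rewrite -Et !inE eqxx !orbT in x2.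
    + by move=> [_ <- _]; rewrite !inE eqxx !orbT.
  have := congr1 (last 0) E; rewrite E23 !last_cat last_rcons /= => ->.
  by rewrite mem_rcons mem_head.
- by move: (ncuw x y); rewrite subuw //= xv yv.
Qed.

(** Two insertions: [v] between the two copies of [a], then the resulting block between [u] and
    [w]. *)
Lemma noncrossing_surround a v u w :
  a \notin v -> a \notin u -> a \notin w -> {in v, forall x, x \notin u ++ w} ->
  noncrossing v -> noncrossing (u ++ w) -> noncrossing (surround a v (u, w)).
Proof.
move=> av au aw dis ncv ncuw; rewrite /surround /= -cat_cons -cat_rcons -cats1.
apply: noncrossing_insert => //; last first.
  rewrite cat_cons -cat1s; apply: noncrossing_insert => //.
    by move=> x xv; rewrite !inE orbb; apply: contraNneq av => <-.
  by move=> x y; apply/negP => /size_subseq.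
move=> x; case: (eqVneq x a) => [-> _|xa]; first by rewrite mem_cat negb_or au.
by rewrite !(mem_cat, inE) (negPf xa) orbF -mem_cat => /dis.
Qed.

Lemma count_mem_double (s : seq nat) x : uniq s ->
  count_mem x (s ++ s) = (x \in s) * 2.
Proof. by move=> us; rewrite count_cat count_uniq_mem // muln2 addnn. Qed.

Lemma split_twice (a : nat) w : count_mem a w = 2 ->
  exists u v z, [/\ w = surround a v (u, z), a \notin u, a \notin v & a \notin z].
Proof.
have first_occ s : a \in s -> exists s1 s2, s = s1 ++ a :: s2 /\ a \notin s1.
  move=> sa; exists (take (index a s) s), (drop (index a s).+1 s).
  rewrite -[a in a :: _](nth_index 0 sa) -drop_nth ?index_mem // cat_take_drop.
  by split=> //; rewrite -has_pred1 has_take_leq ?find_size // /index ltnn.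
move=> c2; have aw : a \in w by rewrite -has_pred1 has_count c2.
have [u [r [wE au]]] := first_occ _ aw.
have /(first_occ _)[v [z [rE av]]] : a \in r.
  move: c2; rewrite wE count_cat /= eqxx (count_memPn au) -has_pred1 has_count.
  by case: (count _ _).
exists u, v, z; split=> //; first by rewrite wE rE.
apply/count_memPn; move: c2; rewrite wE rE count_cat /= eqxx count_cat /= eqxx.
by rewrite (count_memPn au) (count_memPn av) => -[].
Qed.

Lemma perm_surround a v u z :
  perm_eq (surround a v (u, z)) ([:: a; a] ++ v ++ u ++ z).
Proof. by apply/permP => p; rewrite /surround /= !count_cat /= !count_cat /=; lia. Qed.

Lemma qs_words_sound n s w : sorted ltn s -> w \in qs_words n s ->
  perm_eq w (s ++ s) /\ noncrossing w.
Proof.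
elim: n s w => [|n IH] [|a s] w // ss.
- by rewrite inE => /eqP->.
- by rewrite inE => /eqP->.
have us : uniq (a :: s) := sorted_uniq ltn_trans ltnn ss.
have us' : uniq s by case/andP: us.
have ss' : sorted ltn s := path_sorted ss.
have sf p : sorted ltn (filter p s) by apply: sorted_filter ss'; exact: ltn_trans.
case/mem_qs_words_cons=> ab [v [u [z [/(splitsP _ us')[p ->] /= vs uzs ->]]]].
have [pv ncv] := IH _ _ (sf _) vs; have [pu ncu] := IH _ _ (sf _) uzs.
have vE x : (x \in v) = (x \in s) && p x.
  by rewrite (perm_mem pv) mem_cat orbb mem_filter andbC.
have uzE x : (x \in u ++ z) = (x \in s) && ~~ p x.
  by rewrite (perm_mem pu) mem_cat orbb mem_filter andbC.
have as_ : a \notin s by case/andP: us.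
split.
  rewrite (permPl (perm_surround _ _ _ _)).
  apply/permP => q.
  have sE : count q s = count q (filter p s) + count q [seq x <- s | ~~ p x].
    by rewrite -count_cat; apply/permP; rewrite perm_sym perm_filterC.
  have /permP/(_ q) := pv; have /permP/(_ q) := pu.
  rewrite !count_cat /= ?count_cat /= sE => -> ->.
  move: (nat_of_bool _) (count _ _) (count _ _) => x y z'; lia.
have : a \notin u ++ z by rewrite uzE (negPf as_).
rewrite mem_cat => /norP[au az].
apply: noncrossing_surround => //; first by rewrite vE (negPf as_).
by move=> x; rewrite vE uzE => /andP[-> ->].
Qed.

(** Cutting [w] at the two copies of its least letter [a], no letter occurs both between them and
    outside. So each other letter occurs twice in [v] or twice in [u ++ z], and induction applies to
    both words. *)
Lemma qs_words_complete n s w : sorted ltn s -> size s <= n ->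
  perm_eq w (s ++ s) -> noncrossing w -> w \in qs_words n s.
Proof.
elim: n s w => [|n IH] [|a s] w // ss.
- by move=> _ /perm_nilP->.
- by move=> _ /perm_nilP->.
rewrite [size _]/= ltnS => sz pw ncw.
have us : uniq (a :: s) := sorted_uniq ltn_trans ltnn ss.
have us' : uniq s by case/andP: us.
have ss' : sorted ltn s := path_sorted ss.
have sf p : sorted ltn (filter p s) by apply: sorted_filter ss'; exact: ltn_trans.
have szf p : size (filter p s) <= n by rewrite size_filter (leq_trans (count_size _ _)).
have cw x : count_mem x w = (x \in a :: s) * 2.
  by rewrite -count_mem_double //; apply/permP.
have [u [v [z [wE au av az]]]] : exists u v z,
    [/\ w = surround a v (u, z), a \notin u, a \notin v & a \notin z].
  by apply: split_twice; rewrite cw mem_head.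
(* A copy of [x] in [u] would produce the pattern [x a x a], and one in [z] the pattern
   [a x a x]. *)
have nca x : x \in v -> (x \notin u) && (x \notin z).
  have surE : w = u ++ [:: a] ++ v ++ [:: a] ++ z by [].
  move=> xv; apply/andP; split; apply/negP => xin.
    have /negP := ncw x a; apply; rewrite surE.
    rewrite -[[:: x; a; x; a]]/([:: x] ++ [:: a] ++ [:: x] ++ [:: a] ++ [::]).
    by do !apply: cat_subseq; rewrite ?sub0seq ?sub1seq ?mem_seq1.
  have /negP := ncw a x; apply; rewrite surE.
  rewrite -[[:: a; x; a; x]]/([::] ++ [:: a] ++ [:: x] ++ [:: a] ++ [:: x]).
  by do !apply: cat_subseq; rewrite ?sub0seq ?sub1seq ?mem_seq1.
have cvx x : count_mem x w = (x == a) * 2 + count_mem x v + count_mem x (u ++ z).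
  rewrite wE; have /permP-> := perm_surround a v u z.
  by rewrite !count_cat /= eq_sym; lia.
have perm_sub (t : seq nat) p : (forall x, count_mem x t = (x \in s) && p x * 2) ->
    perm_eq t (filter p s ++ filter p s).
  move=> ct; apply/allP => x _ /=; rewrite ct count_mem_double ?filter_uniq //.
  by rewrite mem_filter andbC.
have as_ : a \notin s by case/andP: us.
apply/mem_qs_words_cons.
exists (filter (mem v) s, filter (fun x => x \notin v) s), v, u, z; split=> //.
- by apply/splitsP => //; exists (mem v).
- apply: (IH _ _ (sf _) (szf _)); last first.
    apply: noncrossing_subseq ncw; rewrite wE.
    apply: subseq_trans (suffix_subseq u _).
    by apply: subseq_trans (subseq_cons _ a); exact: prefix_subseq.
  apply: perm_sub => x /=; move: (cw x) (cvx x); rewrite inE.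
  case xv: (x \in v); last first.
    by move=> _ _; rewrite andbF (count_memPn _) ?xv.
  have /andP[xu xz] := nca x xv.
  have xa : x != a by apply: contraNneq av => <-.
  rewrite (negPf xa) count_cat (count_memPn xu) (count_memPn xz) andbT /=.
  by move=> -> ->; lia.
- apply: (IH _ _ (sf _) (szf _)); last first.
    apply: noncrossing_subseq ncw; rewrite wE; apply: cat_subseq => //.
    by rewrite -cat_rcons -cat_cons; exact: suffix_subseq.
  apply: perm_sub => x /=; move: (cw x) (cvx x); rewrite inE.
  case xv: (x \in v).
    have /andP[xu xz] := nca x xv.
    by rewrite andbF count_cat (count_memPn xu) (count_memPn xz).
  rewrite (count_memPn (negbT xv)) andbT.
  case: eqP => [->|_] /=; last by move=> -> /=; lia.
  rewrite (negPf as_) => -> /=; lia.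
Qed.

(** * Absence of repetitions in the enumeration *)

(** Since [key] recovers the index from an element, the lists [t k] are pairwise disjoint. *)
Lemma uniq_flatten_key (T K : eqType) (s : seq K) (t : K -> seq T) (key : T -> K) :
  uniq s -> {in s, forall k, uniq (t k)} ->
  (forall k x, k \in s -> x \in t k -> key x = k) ->
  uniq [seq x | k <- s, x <- t k].
Proof.
elim: s => //= k s IH /andP[ks us] ut keyE.
rewrite map_id cat_uniq ut ?mem_head //= IH ?andbT //; first last.
- by move=> k' x k's; apply: keyE; rewrite inE k's orbT.
- by move=> k' k's; apply: ut; rewrite inE k's orbT.
apply/hasPn => x /allpairsPdep[k' [y [k's yt ->]]]; apply: contra ks => /= yk.
by rewrite -(keyE k y) ?mem_head // (keyE k' y) // inE k's orbT.
Qed.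

Lemma splits_uniq (s : seq nat) : uniq s -> uniq (splits s).
Proof.
elim: s => //= a s IH /andP[as_ us].
rewrite cat_uniq !map_inj_uniq ?IH ?andbT //=; last first.
- by move=> [b c] [b' c'] /= [-> ->].
- by move=> [b c] [b' c'] /= [-> ->].
apply/hasPn => _ /mapP[[b c] /(splitsP _ us)[p [-> _]] ->].
apply/mapP => -[[b' c'] _ /= [E _]].
have : a \in [seq x <- s | p x] by rewrite E mem_head.
by rewrite mem_filter (negPf as_) andbF.
Qed.

Lemma cuts_uniq r : uniq (cuts r).
Proof.
rewrite map_inj_in_uniq ?iota_uniq // => i j; rewrite !mem_iota !add0n !ltnS /=.
by move=> ir jr [/(congr1 size)]; rewrite !size_takel.
Qed.

Lemma cat_cons_inj (a : nat) s1 s2 t1 t2 : a \notin s1 -> a \notin t1 ->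
  s1 ++ a :: s2 = t1 ++ a :: t2 -> s1 = t1 /\ s2 = t2.
Proof.
move=> as1 at1 E; have sz : size s1 = size t1.
  have := congr1 (index a) E.
  by rewrite !index_cat (negPf as1) (negPf at1) /= eqxx !addn0.
by move/eqP: E; rewrite eqseq_cat // eqseq_cons => /and3P[/eqP-> _ /eqP->].
Qed.

Lemma qs_words_uniq n s : sorted ltn s -> uniq (qs_words n s).
Proof.
elim: n s => [|n IH] [|a s] // ss.
have us : uniq (a :: s) := sorted_uniq ltn_trans ltnn ss.
have us' : uniq s by case/andP: us.
have as_ : a \notin s by case/andP: us.
have ss' : sorted ltn s := path_sorted ss.
have sf p : sorted ltn (filter p s) by apply: sorted_filter ss'; exact: ltn_trans.
have memf p w x : w \in qs_words n (filter p s) -> (x \in w) = p x && (x \in s).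
  case/(qs_words_sound (sf p)) => /perm_mem-> _.
  by rewrite mem_cat orbb mem_filter.
rewrite [qs_words _ _]/qs_words -/qs_words map_inj_in_uniq.
  (* The split is recovered from the letters of [v], and below it the word [r] is recovered by
     joining the two parts of its cut. *)
  apply: (@uniq_flatten_key (seq nat * (seq nat * seq nat))%type
     (seq nat * seq nat)%type (splits s) _ (fun x =>
     ([seq y <- s | y \in x.1], [seq y <- s | y \notin x.1]))).
  - exact: splits_uniq.
  - move=> ab /(splitsP _ us')[p ->].
    apply: allpairs_uniq; [exact: (IH _ (sf _))| |by move=> [? ?] [? ?] _ _ /= [-> ->]].
    apply: (@uniq_flatten_key (seq nat * seq nat)%type (seq nat) _ _
      (fun uw => uw.1 ++ uw.2)); first exact: (IH _ (sf _)).
      by move=> r _; exact: cuts_uniq.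
    by move=> r uw _ /cutsP.
  - move=> ab x /(splitsP _ us')[p ->] /allpairsP[[v uw] [vs _ ->]].
    congr (_, _); apply: eq_in_filter => y ys /=; rewrite (memf _ _ _ vs) ys andbT //.
(* With [a] absent from [v] and [u], the first two occurrences of [a] in the surrounded word mark
   the ends of [u] and [v], which makes [surround] injective here. *)
have noa x : x \in [seq x | ab <- splits s,
             x <- [seq (v, uw) | v <- qs_words n ab.1,
                                 uw <- [seq uw | r <- qs_words n ab.2, uw <- cuts r]]] ->
    (a \notin x.1) && (a \notin x.2.1).
  case/allpairsPdep=> ab [_ [/(splitsP _ us')[p ->] /allpairsP[[v uw] [vs uws ->]] ->]].
  case/allpairsPdep: uws => r [[u z] [rs /cutsP rE uwE]].
  rewrite (memf _ _ _ vs) (negPf as_) andbF /=.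
  have : a \notin r by rewrite (memf _ _ _ rs) (negPf as_) andbF.
  by move: uwE => /= ->; rewrite rE mem_cat => /norP[].
move=> [v [u z]] [v' [u' z']] /noa /= /andP[av au] /noa /= /andP[av' au'].
rewrite /surround /= => /cat_cons_inj[]// -> /cat_cons_inj[]// -> -> //.
Qed.

Local Open Scope ring_scope.

(** * Solution of the recurrence *)

(** With [x = 1 / (1 - t)] one has [dx/dt = x^2] and [t x = x - 1], so [t d/dt] sends [x] to
    [x^2 - x]. *)
Definition theta (p : {poly rat}) : {poly rat} := ('X ^+ 2 - 'X) * p^`().

Lemma theta_is_linear : linear theta.
Proof. by move=> a p q; rewrite /theta derivD derivZ mulrDr scalerAr. Qed.

HB.instance Definition _ :=
  GRing.isLinear.Build rat {poly rat} {poly rat} *:%R theta theta_is_linear.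

Lemma thetaM p q : theta (p * q) = theta p * q + p * theta q.
Proof. by rewrite /theta derivM; ring. Qed.

Lemma thetaZ (c : rat) p : theta (c *: p) = c *: theta p.
Proof. exact: linearZ. Qed.

Lemma theta_iterZ n (c : rat) p : iter n theta (c *: p) = c *: iter n theta p.
Proof. by elim: n => //= n ->; rewrite thetaZ. Qed.

Lemma map_thetaM (P Q : {poly {poly rat}}) :
  map_poly theta (P * Q) = map_poly theta P * Q + P * map_poly theta Q.
Proof.
apply/polyP=> i; rewrite coefD coef_map !coefM raddf_sum -big_split /=.
by apply: eq_bigr => j _; rewrite !coef_map thetaM.
Qed.

Lemma map_thetaX (P : {poly {poly rat}}) k :
  map_poly theta (P ^+ k.+1) = (P ^+ k * map_poly theta P) *+ k.+1.
Proof.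
elim: k => [|k IH]; first by rewrite expr1 expr0 mul1r.
by rewrite exprS map_thetaM IH exprS; ring.
Qed.

Lemma coef_mul_eq0 (R : nzRingType) (P Q : {poly R}) N :
  (forall i, (i < N)%N -> Q`_i = 0) -> forall i, (i < N)%N -> (P * Q)`_i = 0.
Proof.
move=> Q0 i ltiN; rewrite coefM big1 // => j _.
by rewrite Q0 ?mulr0 // (leq_ltn_trans (leq_subr _ _)).
Qed.

Lemma fact_neq0 n : (n`!)%:R != 0 :> rat.
Proof. by rewrite Num.Theory.pnatr_eq0 -lt0n fact_gt0. Qed.

Section Burgers.

Variable h : nat -> {poly rat}.
Hypothesis h_rec : forall n,
  h n.+1 = \sum_(k < n.+1) (h (n - k)%N * theta (h k)) *+ 'C(n, k).

(** The exponential generating series of [h] in the outer variable [z], cut at degree [N] to stay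
    among polynomials; identities hold only in low degrees. *)
Let H N : {poly {poly rat}} := \poly_(i < N) ((i`!)%:R^-1 *: h i).

(** Dividing [h_rec] by [i!] turns the binomial sum into a Cauchy product. The bound is on [i.+1]
    because the derivative reads the next coefficient. *)
Lemma burgers_eq N i : (i.+1 < N)%N ->
  ((H N)^`() - H N * map_poly theta (H N))`_i = 0.
Proof.
move=> ltiN; rewrite coefB coef_deriv !coef_poly ltiN coefM h_rec.
apply/eqP; rewrite subr_eq0; apply/eqP.
rewrite scaler_sumr -sumrMnl (reindex_inj rev_ord_inj) /=.
apply: eq_bigr => j _.
have lt_jn : (j <= i)%N by rewrite -ltnS.
rewrite coef_map !coef_poly subSS.
have -> : (i - (i - j) = j)%N by lia.
rewrite !(leq_ltn_trans _ ltiN) ?(leq_trans lt_jn) ?ltnS ?leq_subr //; last first.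
  by rewrite (leq_trans (leq_subr _ _)).
rewrite /= thetaZ -scalerAl -scalerAr scalerA.
rewrite -!scaler_nat !scalerA bin_sub //.
congr (_ *: _).
have := bin_fact lt_jn; rewrite factS natrM => /(congr1 (fun m => m%:R : rat)).
rewrite !natrM => <-.
have := fact_neq0 j; have := fact_neq0 (i - j)%N.
have : 'C(i,j)%:R != 0 :> rat by rewrite Num.Theory.pnatr_eq0 -lt0n bin_gt0.
have : 1 + i%:R != 0 :> rat by rewrite nat1r Num.Theory.pnatr_eq0.
by move=> ????; field; apply/and4P.
Qed.

(** The difference of the two sides is a coefficient of [(k+1)(k+2) H^k] times the defect
    [H' - H theta(H)], which vanishes below degree [N - 1]. *)
Lemma burgers_power N k i : (i.+1 < N)%N ->
  ((H N ^+ k.+1)`_i.+1 *+ i.+1) *+ k.+2 = theta (H N ^+ k.+2)`_i *+ k.+1.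
Proof.
move=> ltiN; apply/eqP; rewrite -subr_eq0; apply/eqP.
rewrite -coef_deriv -[theta _](@coef_map _ _ theta) -!coefMn -coefB.
have -> : (H N ^+ k.+1)^`() *+ k.+2 - map_poly theta (H N ^+ k.+2) *+ k.+1
    = (H N ^+ k *+ (k.+1 * k.+2)) * ((H N)^`() - H N * map_poly theta (H N)).
  by rewrite deriv_exp map_thetaX /= !exprS; ring.
apply: (@coef_mul_eq0 _ _ _ N.-1) => [j ltj|]; last by lia.
by apply: burgers_eq; lia.
Qed.

(* [H] satisfies the inviscid Burgers equation [dH/dz = H * theta H], so
   [(k + 1) * d(H^k)/dz = k * theta (H^(k+1))]: each [z]-derivative is traded
   for a [theta] and one more power of [H]. *)
Lemma burgers_solution n : h n *+ n.+1 = iter n theta (h 0%N ^+ n.+1).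
Proof.
(* After [j] exchanges, [n ^_ j] is the factor left by [j] derivatives of [z^n]. At [j = n] it is
   [n!], cancelling the denominator in [H], and only the constant coefficient of the power
   remains. *)
have key j : (j <= n)%N ->
    ((H n.+1)`_n *+ (n ^_ j)) *+ j.+1 = iter j theta (H n.+1 ^+ j.+1)`_(n - j).
  elim: j => [|j IH] ltjn; first by rewrite subn0 expr1 ffactn0.
  have [i Ei] : exists i, (n - j = i.+1)%N by exists (n - j).-1; lia.
  have Ei' : (n - j.+1 = i)%N by lia.
  have lt_i : (i.+1 < n.+1)%N by lia.
  have := burgers_power j lt_i; rewrite Ei' iterSr -Ei.
  have := IH (ltnW ltjn).
  rewrite -!scaler_nat => IHj /(congr1 (iter j theta)).
  rewrite !theta_iterZ -IHj => E.
  apply: (@scalerI _ _ (j.+1%:R)); first by rewrite Num.Theory.pnatr_eq0.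
  rewrite -E !scalerA; congr (_ *: _).
  by rewrite ffactnSr natrM; ring.
have := key n (leqnn n); rewrite subnn ffactnn coef_poly ltnSn.
rewrite -!scaler_nat !scalerA -mulrA mulfV ?fact_neq0 // mulr1 => ->.
congr (iter n theta _); rewrite -!horner_coef0 horner_exp horner_coef0 coef_poly /=.
by rewrite invr1 scale1r.
Qed.

End Burgers.

(** * Expansion of polynomials in [x] as power series in [t] *)

(* The coefficient of [t ^ m] in [(1 - t) ^ (- k)]. *)
Definition geom_coef (m k : nat) : rat :=
  if k is k'.+1 then 'C(m + k', m)%:R else (m == 0%N)%:R.

(* The expansion in powers of [t] of a polynomial in [x = 1 / (1 - t)]. *)
Definition expand (p : {poly rat}) : fps :=
  fun m => \sum_(k < size p) p`_k * geom_coef m k.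

Lemma expand_wide (p : {poly rat}) m N : (size p <= N)%N ->
  expand p m = \sum_(k < N) p`_k * geom_coef m k.
Proof.
move=> leN; rewrite /expand (big_ord_widen N (fun k => p`_k * geom_coef m k)) //.
rewrite big_mkcond; apply: eq_bigr => k _; case: ltnP => // le_k.
by rewrite nth_default ?mul0r.
Qed.

Lemma expandP a p q m : expand (a *: p + q) m = a * expand p m + expand q m.
Proof.
pose N := maxn (size (a *: p + q)) (maxn (size p) (size q)).
rewrite !(@expand_wide _ m N) ?leq_max ?leqnn ?orbT // mulr_sumr -big_split /=.
by apply: eq_bigr => k _; rewrite coefD coefZ; ring.
Qed.

Lemma expand0 m : expand 0 m = 0.
Proof. by rewrite /expand size_poly0 big_ord0. Qed.

Lemma expandXn k m : expand 'X^k m = geom_coef m k.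
Proof.
rewrite /expand size_polyXn big_ord_recr /= coefXn eqxx mul1r big1 ?add0r // => i _.
by rewrite coefXn ltn_eqF ?ltn_ord // mul0r.
Qed.

Lemma expandD p q m : expand (p + q) m = expand p m + expand q m.
Proof. by rewrite -[p in LHS]scale1r expandP mul1r. Qed.

Lemma expandZ c p m : expand (c *: p) m = c * expand p m.
Proof. by rewrite -[_ *: _]addr0 expandP expand0 addr0. Qed.

Lemma expandB p q m : expand (p - q) m = expand p m - expand q m.
Proof. by rewrite expandD -scaleN1r expandZ mulN1r. Qed.

Lemma expand_sum I (r : seq I) (P : pred I) (F : I -> {poly rat}) m :
  expand (\sum_(i <- r | P i) F i) m = \sum_(i <- r | P i) expand (F i) m.
Proof. exact: (big_morph (expand^~ m) (fun p q => expandD p q m) (expand0 m)). Qed.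

Lemma poly_lin_ind (P : {poly rat} -> Prop) :
  (forall k, P 'X^k) -> (forall a p q, P p -> P q -> P (a *: p + q)) ->
  forall p, P p.
Proof.
move=> PX PD p.
have P0 : P 0 by have := PD (-1) 1 1 (PX 0%N) (PX 0%N); rewrite scaleN1r addNr.
rewrite -[p]coefK poly_def; elim/big_rec: _ => // i q _ Pq.
exact: PD.
Qed.

Lemma theta_Xn k : theta 'X^k = ('X^(k.+1) - 'X^k) *+ k.
Proof.
case: k => [|k]; first by rewrite /theta derivXn !mulr0n mulr0.
by rewrite /theta derivXn /= !exprS; ring.
Qed.

(** Pascal's rule, as the coefficient form of [(1 - t) x^(k+1) = x^k]. *)
Lemma geom_coefS m k : geom_coef m.+1 k.+1 = geom_coef m k.+1 + geom_coef m.+1 k.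
Proof.
case: k => [|k] /=; first by rewrite !addn0 !binn addr0.
by rewrite addSn binS -natrD addnC addSnnS.
Qed.

(** On [x^k], [theta] multiplies the coefficient of [t^m] by [m], as [t d/dt] must. For positive [m]
    and [k] this is [k C(m+k-1, m-1) = m C(m+k-1, m)]. *)
Lemma geom_coef_theta m k :
  (geom_coef m k.+1 - geom_coef m k) *+ k = m%:R * geom_coef m k.
Proof.
case: m => [|m].
  by case: k => [|k] /=; rewrite ?mulr0n ?mul0r // !bin0 subrr mul0rn.
rewrite geom_coefS addrK; case: k => [|k] /=; first by rewrite mulr0n mulr0.
rewrite -mulrnA -natrM; congr (_%:R).
by rewrite addSnnS mul_bin_left addKn mulnC.
Qed.

Lemma expand_theta p m : expand (theta p) m = m%:R * expand p m.
Proof.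
elim/poly_lin_ind: p => [k|a p q IHp IHq].
  by rewrite theta_Xn -scaler_nat expandZ expandB !expandXn -geom_coef_theta mulr_natl.
by rewrite linearP !expandD !expandZ IHp IHq; ring.
Qed.

Lemma expand_iter_theta n p m :
  expand (iter n theta p) m = m%:R ^+ n * expand p m.
Proof.
by elim: n => [|n IH] /=; rewrite ?mul1r // expand_theta IH exprS mulrA.
Qed.

(** The identity [(1 - t) x p = p], read on coefficients. *)
Lemma expand_mulX p m :
  expand ('X * p) m - (if m is m'.+1 then expand ('X * p) m' else 0) = expand p m.
Proof.
elim/poly_lin_ind: p => [k|a p q IHp IHq].
  rewrite -exprS !expandXn; case: m => [|m].
    by rewrite subr0; case: k => [|k] //=; rewrite !bin0.
  by rewrite expandXn geom_coefS addrC addKr.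
rewrite expandD expandZ -IHp -IHq mulrDr -scalerAr.
by case: m {IHp IHq} => [|m]; rewrite !expandD !expandZ; ring.
Qed.

(** A single coefficient of a product sees only finitely many terms of [u], so the ring laws of
    polynomials become available for series. *)
Lemma fps_mul_trunc (u : fps) q m N : (m < N)%N ->
  fps_mul u (fps_of_poly q) m = ((\poly_(i < N) u i) * q)`_m.
Proof.
move=> ltmN; rewrite coefM; apply: eq_bigr => i _; rewrite coef_poly.
by rewrite (leq_trans _ ltmN).
Qed.

(** The hypothesis says [(1 - t) u = v]; the factor [1 - t] passes from the polynomial to the
    series. *)
Lemma fps_mul_1BX (u v : fps) q m :
  (forall i, u i - (if i is i'.+1 then u i' else 0) = v i) ->
  fps_mul u (fps_of_poly ((1 - 'X) * q)) m = fps_mul v (fps_of_poly q) m.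
Proof.
move=> uv; rewrite (@fps_mul_trunc _ _ m m.+1) // mulrA coefM.
apply: eq_bigr => i _; congr (_ * _).
rewrite mulrBr mulr1 coefB coefMX !coef_poly ltn_ord -uv.
by case: i => [[|i] /= lti] //; rewrite (ltnW lti).
Qed.

Lemma fps_mulD (u : fps) p q m :
  fps_mul u (fps_of_poly (p + q)) m =
  fps_mul u (fps_of_poly p) m + fps_mul u (fps_of_poly q) m.
Proof. by rewrite !(@fps_mul_trunc _ _ m m.+1) // mulrDr coefD. Qed.

Lemma expand_cancel_X p q m :
  fps_mul (expand ('X * p)) (fps_of_poly ((1 - 'X) * q)) m =
  fps_mul (expand p) (fps_of_poly q) m.
Proof. by apply: fps_mul_1BX => i; exact: expand_mulX. Qed.

(* In terms of [x = 1 / (1 - t)] one has [x - 1 = x t]. *)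
Lemma expand_cancel_XB1 p q m :
  fps_mul (expand (('X - 1) * p)) (fps_of_poly ((1 - 'X) * q)) m =
  fps_mul (expand p) (fps_of_poly ('X * q)) m.
Proof.
rewrite (_ : 'X * q = q - (1 - 'X) * q); last by ring.
rewrite fps_mulD -(expand_cancel_X p q) /fps_mul -big_split /=.
apply: eq_bigr => i _; rewrite (_ : ('X - 1) * p = 'X * p - p); last by ring.
by rewrite expandB /fps_of_poly coefN; ring.
Qed.

Lemma expand_monomial d k m :
  fps_mul (expand (('X - 1) ^+ d * 'X^k)) (fps_of_poly ((1 - 'X) ^+ (d + k))) m
  = ('X^d : {poly rat})`_m.
Proof.
(* The extra factor [q] absorbs the powers of [1 - t] not yet cancelled and the powers of [t]
   already produced. *)
suff gen q : fps_mul (expand (('X - 1) ^+ d * 'X^k))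
    (fps_of_poly ((1 - 'X) ^+ (d + k) * q)) m = ('X^d * q)`_m.
  by have := gen 1; rewrite !mulr1.
elim: d q => [|d IH] q.
  elim: k q => [|k IH] q.
    rewrite !mul1r /fps_mul big_ord_recl big1 => [|i _].
      by rewrite expandXn mul1r subn0 addr0.
    by rewrite expandXn mul0r.
  have := IH q; rewrite !mul1r add0n => {}IH.
  by rewrite add0n exprS [(1 - 'X) ^+ _]exprS -mulrA expand_cancel_X IH.
rewrite addSn !exprS -!mulrA expand_cancel_XB1 mulrCA.
by rewrite IH mulrCA.
Qed.

(** * Generating polynomials of words *)

(* With [x = 1 / (1 - t)], this is [t ^ des w / (1 - t) ^ (size w + 1)]. *)
Definition des_weight (w : seq nat) : {poly rat} :=
  ('X - 1) ^+ des w * 'X^((size w).+1 - des w).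

(** Since [x^2 - x = x (x - 1)], differentiating either factor restores its exponent and raises the
    other exponent by one. *)
Lemma theta_monomial d e :
  theta (('X - 1) ^+ d * 'X^e) =
  (('X - 1) ^+ d * 'X^(e.+1)) *+ d + (('X - 1) ^+ d.+1 * 'X^e) *+ e.
Proof.
rewrite thetaM theta_Xn /theta deriv_exp derivB derivX derivC subr0.
case: d => [|d]; rewrite !(exprS, expr0) /=; ring.
Qed.

(** The two terms of [theta] on the weight of [r] match the two kinds of gaps: [des r] gaps keep the
    number of descents, the other [size r + 1 - des r] raise it by one. *)
Lemma sum_cuts_weight a v r :
  all (fun y => a < y)%N v -> all (fun y => a < y)%N r ->
  \sum_(uw <- cuts r) des_weight (surround a v uw) =
  des_weight v * theta (des_weight r).
Proof.
move=> av ar; pose f g := des_weight v * (('X - 1) ^+ g * 'X^((size r).+2 - g)).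
transitivity (\sum_(uw <- cuts r) f (gap_des uw)).
  apply: eq_big_seq => -[u z] /cutsP /= rE; rewrite rE all_cat in ar.
  have [au az] := andP ar.
  have le_g : (gap_des (u, z) <= (size r).+1)%N.
    rewrite rE size_cat /gap_des /=.
    have := des_size u; have := des_size z; case: (nilp z) => /=; lia.
  have le_v := des_size v.
  rewrite /des_weight des_surround //= -/(gap_des (u, z)) /f /des_weight exprD.
  (* The two copies of [a] account for the shift from [(size r).+1] to [(size r).+2]; [le_v] and
     [le_g] keep the natural subtractions exact. *)
  have -> : ((size (surround a v (u, z))).+1 - (des v + gap_des (u, z)) =
     ((size v).+1 - des v) + ((size r).+2 - gap_des (u, z)))%N.
    by rewrite rE /surround !size_cat /= !size_cat /= in le_g *; lia.
  by rewrite exprD; ring.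
rewrite sum_cuts /f /des_weight theta_monomial.
have le_r := des_size r.
have -> : ((size r).+2 - des r = ((size r).+1 - des r).+1)%N by lia.
have -> : ((size r).+2 - (des r).+1 = (size r).+1 - des r)%N by lia.
by rewrite mulrDr !mulrnAr.
Qed.

Lemma sum_qs_words_cons n a s : sorted ltn (a :: s) ->
  \sum_(w <- qs_words n.+1 (a :: s)) des_weight w =
  \sum_(ab <- splits s) (\sum_(v <- qs_words n ab.1) des_weight v) *
                        theta (\sum_(r <- qs_words n ab.2) des_weight r).
Proof.
move=> ss.
have us' : uniq s by have /andP[] := sorted_uniq ltn_trans ltnn ss.
have ss' : sorted ltn s := path_sorted ss.
have sf p : sorted ltn (filter p s) by apply: sorted_filter ss'; exact: ltn_trans.
have alls : all (ltn a) s by apply: order_path_min ss; exact: ltn_trans.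
have allw p w : w \in qs_words n (filter p s) -> all (fun y => a < y)%N w.
  case/(qs_words_sound (sf p)) => pw _; apply/allP => x.
  rewrite (perm_mem pw) mem_cat orbb mem_filter => /andP[_].
  exact: (allP alls).
rewrite [qs_words _ _]/qs_words -/qs_words big_map big_allpairs_dep.
apply: eq_big_seq => ab /(splitsP _ us')[p ->].
rewrite big_allpairs mulr_suml; apply: eq_big_seq => v /allw av.
rewrite big_allpairs_dep raddf_sum mulr_sumr; apply: eq_big_seq => r /allw ar.
exact: sum_cuts_weight.
Qed.

(** The summand depends only on the two sizes; sending [x] left or right gives Pascal's rule. *)
Lemma sum_splits (T : Type) (R : zmodType) (F : nat -> nat -> R) (s : seq T) :
  \sum_(ab <- splits s) F (size ab.1) (size ab.2) =
  \sum_(k < (size s).+1) F (size s - k)%N k *+ 'C(size s, k).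
Proof.
elim: s F => [|x s IH] F; first by rewrite big_seq1 big_ord1.
rewrite /= big_cat !big_map /= (IH (fun i j => F i.+1 j)) (IH (fun i j => F i j.+1)).
set n := size s; rewrite [RHS]big_ord_recl /=.
rewrite [X in X + _ = _]big_ord_recl /= -addrA.
congr (_ + _); first by rewrite !bin0 !subn0.
(* The first sum, stripped of its initial term, is shifted by one and completed by a term with
   ['C(n, n.+1) = 0]. *)
transitivity (\sum_(i < n.+1) F (n - i)%N i.+1 *+ 'C(n, i.+1) +
              \sum_(i < n.+1) F (n - i)%N i.+1 *+ 'C(n, i)).
  congr (_ + _); rewrite big_ord_recr /= bin_small // mulr0n addr0.
  apply: eq_bigr => i _; rewrite /bump /= add1n; congr (F _ _ *+ _).
  by have := ltn_ord i; lia.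
by rewrite -big_split; apply: eq_bigr => i _; rewrite /= /bump /= add1n subSS binS mulrnDr.
Qed.

Definition qs_sum (n : nat) : {poly rat} :=
  \sum_(w <- qs_words n (iota 1 n)) des_weight w.

(** Taking the induction hypothesis as a premise lets this serve both the proof that the sum depends
    only on the size and the recurrence itself. *)
Lemma sum_qs_words_step n a s :
  (forall t, sorted ltn t -> (size t <= n)%N ->
     \sum_(w <- qs_words n t) des_weight w = qs_sum (size t)) ->
  sorted ltn (a :: s) -> (size s <= n)%N ->
  \sum_(w <- qs_words n.+1 (a :: s)) des_weight w =
  \sum_(k < (size s).+1) (qs_sum (size s - k)%N * theta (qs_sum k)) *+ 'C(size s, k).
Proof.
move=> IH ss sz; rewrite sum_qs_words_cons //.
rewrite -(sum_splits (fun i j => qs_sum i * theta (qs_sum j))).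
have us : uniq s by have /andP[] := sorted_uniq ltn_trans ltnn ss.
apply: eq_big_seq => ab /(splitsP _ us)[p ->].
have sf q : sorted ltn (filter q s).
  by apply: sorted_filter (path_sorted ss); exact: ltn_trans.
have szf q : (size (filter q s) <= n)%N.
  by rewrite size_filter (leq_trans (count_size _ _)).
by congr (_ * theta _); apply: (IH _ (sf _) (szf _)).
Qed.

Lemma sum_qs_words n s : sorted ltn s -> (size s <= n)%N ->
  \sum_(w <- qs_words n s) des_weight w = qs_sum (size s).
Proof.
elim/ltn_ind: n s => -[|n] IH [|a s] // ss sz.
rewrite sum_qs_words_step //; last exact: IH.
(* The same right-hand side arises from the letters [1, 2, ...] with the least possible bound, which
   is [qs_sum (size s).+1]. *)
have := @sum_qs_words_step (size s) 1 (iota 2 (size s)) (IH _ sz).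
by rewrite size_iota => <- //; exact: (iota_ltn_sorted 1 (size s).+1).
Qed.

Lemma qs_sum_rec n : qs_sum n.+1 =
  \sum_(k < n.+1) (qs_sum (n - k)%N * theta (qs_sum k)) *+ 'C(n, k).
Proof.
have := @sum_qs_words_step n 1 (iota 2 n) (@sum_qs_words n).
by rewrite size_iota; apply=> //; exact: (iota_ltn_sorted 1 n.+1).
Qed.

Lemma qs_sumE n : qs_sum n = n.+1%:R^-1 *: iter n theta 'X^(n.+1).
Proof.
have := burgers_solution qs_sum_rec n.
have -> : qs_sum 0 = 'X.
  by rewrite /qs_sum big_seq1 /des_weight des_nil mul1r.
move=> <-; rewrite -scaler_nat scalerA mulVf ?scale1r //.
by rewrite Num.Theory.pnatr_eq0.
Qed.

Lemma expand_qs_sum n m : expand (qs_sum n) m = lhs_series n m.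
Proof.
rewrite qs_sumE expandZ expand_iter_theta expandXn /lhs_series /=; ring.
Qed.

(** * Passage from enumerated words to tuples *)

Lemma nth_subseq (T : eqType) (x0 : T) (w : seq T) (I : seq nat) :
  sorted ltn I -> all (fun i => i < size w)%N I ->
  subseq [seq nth x0 w i | i <- I] w.
Proof.
move=> sI aI; have E : [seq nth x0 w i | i <- iota 0 (size w)] = w by exact: mkseq_nth.
rewrite -[w in subseq _ w]E; apply: map_subseq.
(* A strictly increasing list of positions is determined by its members. *)
have -> : I = [seq i <- iota 0 (size w) | i \in I].
  apply: (irr_sorted_eq ltn_trans ltnn) => //.
    by apply: sorted_filter (iota_ltn_sorted _ _); exact: ltn_trans.
  move=> i; rewrite mem_filter mem_iota /= add0n andbC.
  by case: (boolP (i \in I)) => [/(allP aI)->|_]; rewrite ?andbF.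
exact: filter_subseq.
Qed.

Lemma subseq_nth (T : eqType) (x0 : T) (t w : seq T) : subseq t w ->
  exists I, [/\ sorted ltn I, all (fun i => i < size w)%N I & t = map (nth x0 w) I].
Proof.
case/subseqP=> m sm ->; exists (mask m (iota 0 (size w))); split.
- apply: subseq_sorted (mask_subseq _ _) (iota_ltn_sorted _ _); exact: ltn_trans.
- by apply/allP => i /mem_mask; rewrite mem_iota.
- by rewrite map_mask; congr mask; rewrite [RHS]mkseq_nth.
Qed.

Lemma noncrossing_avoids n (w : (2 * n).-tuple 'I_n.+1) :
  noncrossing (word_seq w) <-> avoids_1212 w.
Proof.
have sz : size (word_seq w) = (2 * n)%N by rewrite size_map size_tuple.
have nthE (i : 'I_(2 * n)) : nth 0%N (word_seq w) i = tnth w i :> nat.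
  by rewrite (tnth_nth ord0) (nth_map ord0) // size_tuple.
split=> [nc|av].
  apply/existsP => -[i /existsP[j /existsP[k /existsP[l]]]].
  case/and5P=> ij jk kl /eqP ik /eqP jl.
  have /negP := nc (tnth w i) (tnth w j); apply.
  have := @nth_subseq _ 0%N (word_seq w) [:: i : nat; j : nat; k : nat; l : nat].
  rewrite /= !nthE -ik -jl; apply; first by rewrite ij jk kl.
  by rewrite sz !ltn_ord.
move=> x y; apply: contra av => /(subseq_nth 0%N)[I []].
case: I => [|i [|j [|k [|l [|? ?]]]]] //=.
rewrite sz !andbT => /and3P[ij jk kl] /and4P[ltI ltj ltk ltl] [xi yj xk yl].
apply/existsP; exists (Ordinal ltI); apply/existsP; exists (Ordinal ltj).
apply/existsP; exists (Ordinal ltk); apply/existsP; exists (Ordinal ltl).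
apply/and5P; split=> //=; rewrite -val_eqE /= -!nthE /=.
  by rewrite -xi -xk.
by rewrite -yj -yl.
Qed.

(** The letter [0] is excluded by counting: the nonzero letters already fill all [2 * n] places. *)
Lemma multiset_permP n (w : (2 * n).-tuple 'I_n.+1) :
  is_multiset_perm w = perm_eq (word_seq w) (iota 1 n ++ iota 1 n).
Proof.
have us : uniq (iota 1 n) by exact: iota_uniq.
apply/forallP/idP => [mw|pw k]; last first.
  apply/implyP => k0; have /permP-> := pw.
  by rewrite count_mem_double // mem_iota k0 add1n ltn_ord.
have bnd x : x \in word_seq w -> (x <= n)%N.
  by case/mapP=> y _ ->; rewrite -ltnS.
pose w' := [seq x <- word_seq w | (0 < x)%N].
have pw' : perm_eq w' (iota 1 n ++ iota 1 n).
  apply/allP => x _ /=; rewrite count_mem_double // mem_iota add1n ltnS.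
  rewrite /w' count_filter; case: x => [|x] /=.
    by rewrite (eq_count (a2 := pred0)) ?count_pred0 // => -[].
  rewrite (eq_count (a2 := pred1 x.+1)); last by move=> -[|y] //=; rewrite andbT.
  case: (leqP x.+1 n) => [ltx|gtx].
    by have /implyP/(_ isT) := mw (Ordinal (ltx : x.+1 < n.+1)%N).
  rewrite (count_memPn _) //; apply/negP => /bnd; lia.
have sz : size w' = size (word_seq w).
  by rewrite (perm_size pw') size_cat size_iota size_map size_tuple; lia.
suff <- : w' = word_seq w by [].
by apply/all_filterP; rewrite all_count -size_filter sz.
Qed.

Lemma word_seq_inj n : injective (@word_seq n).
Proof. by move=> u v /(inj_map val_inj) /val_inj. Qed.

(** Neither list has repetitions, so equal membership suffices: completeness gives one inclusion,
    soundness and a return to tuples through [inord] the other. *)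
Lemma perm_word_seq n :
  perm_eq [seq word_seq w | w <- enum (@quasi_stirling n)] (qs_words n (iota 1 n)).
Proof.
have ss : sorted ltn (iota 1 n) by exact: iota_ltn_sorted.
apply: uniq_perm.
- by rewrite map_inj_uniq ?enum_uniq //; exact: word_seq_inj.
- exact: qs_words_uniq.
move=> s; apply/mapP/idP => [[w]|].
  rewrite mem_enum => /andP[]; rewrite multiset_permP => pw /noncrossing_avoids nc ->.
  by apply: qs_words_complete; rewrite ?size_iota.
case/(qs_words_sound ss) => ps ncs.
have sz : size (map (@inord n) s) == (2 * n)%N.
  by rewrite size_map (perm_size ps) size_cat size_iota; apply/eqP; lia.
have ws : word_seq (Tuple sz) = s.
  rewrite /word_seq /= -map_comp map_id_in // => x.
  rewrite (perm_mem ps) mem_cat orbb mem_iota => /andP[_ ltx] /=.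
  by rewrite inordK.
exists (Tuple sz) => //; rewrite mem_enum; apply/andP; split.
  by rewrite multiset_permP ws.
by apply/noncrossing_avoids; rewrite ws.
Qed.

Lemma qs_sum_tuples n :
  qs_sum n = \sum_(w : (2 * n).-tuple 'I_n.+1 | quasi_stirling w)
               des_weight (word_seq w).
Proof.
by rewrite /qs_sum -(perm_big _ (perm_word_seq n)) big_map big_enum.
Qed.

(* Equivalent to LHS = Qbar_n(t) / (1-t)^(2n+1) in rat[[t]], since (1-t)^(2n+1)
   is invertible there. *)
Theorem theorem2p5 (n : nat) :
  fps_mul (lhs_series n) (fps_of_poly ((1 - 'X) ^+ (2 * n).+1)) = fps_of_poly (Qbar n).
Proof.
apply: functional_extensionality => m.
rewrite /fps_of_poly /Qbar coef_sum.
transitivity (fps_mul (expand (qs_sum n)) (fps_of_poly ((1 - 'X) ^+ (2 * n).+1)) m).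
  by apply: eq_bigr => i _; rewrite expand_qs_sum.
rewrite qs_sum_tuples /fps_mul.
under eq_bigr do rewrite expand_sum mulr_suml.
rewrite exchange_big; apply: eq_bigr => w _.
have szw : size (word_seq w) = (2 * n)%N by rewrite size_map size_tuple.
have := des_size (word_seq w); rewrite szw => led.
(* Word by word, the weight times [(1 - t)^(2n+1)] is [t] to the number of descents; [led] makes the
   two exponents add up to [2n + 1]. *)
rewrite -(expand_monomial _ ((2 * n).+1 - des (word_seq w))) subnKC ?(leqW led) //.
by rewrite /des_weight szw.
Qed.
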